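(* Let $f,g,F=f+g$, a Bregman distance $D$ and a parameter $\epsilon$ be as in the context, and let $\overline x\in\overline{\mathbf X}_P$, $\overline F=F(\overline x)$. If one of the following conditions holds, then $F$ satisfies the level-set subdifferential error bound condition at $\overline x$. (i) $F=f+g$ satisfies the KL property (with some exponent $\alpha\in(0,1)$) at $\overline x$ on $\mathfrak{B}(\overline x;\eta,\nu)$. (ii) $F=f+g$ satisfies the Bregman proximal error bound condition at $\overline x$; condition (H$_3$) holds at $\overline x$; and either $g$ is semi-convex, or $g$ is uniformly prox-regular around $\overline x$ and every $x\in\mathfrak{B}(\overline x;\frac\eta2,\frac\nu N)$, with $N\ge\frac{2\overline\epsilon\nu}{m-\overline\epsilon L}\big/\left(\frac\eta2\right)^2$, satisfies Property (A). (iii) $F=f+g$ satisfies weak metric subregularity at $\overline x$ and condition (H$_3$) holds at $\overline x$. (iv) $g=0$ and $f=F$ satisfies the local Polyak-Łojasiewicz (LPL) inequality on $\mathbb{B}(\overline x;\eta)$. Here (H$_3$) is the condition: there is $\delta>0$ such that $F(y)\le F(\overline x)$ whenever $y\in\overline{\mathbf X}_P$ and $\|y-\overline x\|\le\delta$.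
   Context: Assumptions on $f,g$: $f:\mathbb{R}^n\to(-\infty,\infty]$ is a proper lower semicontinuous (possibly nonconvex) function, differentiable on $\mathrm{dom} f$, with $\mathrm{dom} f$ convex and $\nabla f$ $L$-Lipschitz continuous on $\mathrm{dom} f$; $g:\mathbb{R}^n\to(-\infty,\infty]$ is proper, lower semicontinuous (possibly nonconvex and nonsmooth), continuous on $\mathrm{dom} g$, and $\mathrm{dom} g$ is convex; $F=f+g$ is level-bounded, i.e. $\{x: F(x)\le r\}$ is bounded (possibly empty) for every $r\in\mathbb{R}$. Bregman distance: $K:\mathbb{R}^n\to\mathbb{R}$ is twice differentiable, strongly convex with modulus $m>0$, with $\nabla K$ $M$-Lipschitz, and $D(x,y)=K(y)-[K(x)+\langle\nabla K(x),y-x\rangle]$; $0<\underline\epsilon\le\epsilon\le\overline\epsilon$. $T_{D,\epsilon}(x)=\arg\min_{y}\{\langle\nabla f(x),y-x\rangle+g(y)+\frac1\epsilon D(x,y)\}$. $\partial_P\psi(\bar x)=\{\xi:\exists \rho'>0,r>0 \text{ s.t. } \psi(x)\ge\psi(\bar x)+\langle\xi,x-\bar x\rangle-\rho'\|x-\bar x\|^2\ \forall x\in\mathbb{B}(\bar x;r)\}$ (proximal subdifferential; $\mathbb{B}$ open ball); $\partial_L$ the limiting (Mordukhovich) subdifferential; $\overline{\mathbf X}_P=\{x:0\in\partial_PF(x)\}$; $\mathrm{dist}(x,C)=\inf_{z\in C}\|x-z\|$ ($=\infty$ if $C=\emptyset$); $[F\le\overline F]=\{x:F(x)\le\overline F\}$;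 $\mathfrak{B}(\overline x;\eta,\nu)=\mathbb{B}(\overline x;\eta)\cap\{x:\overline F<F(x)<\overline F+\nu\}$ with $\eta,\nu>0$. Level-set subdifferential error bound at $\overline x$: for some exponent $\gamma>0$ there exist $\eta,\nu,c_3>0$ with $\mathrm{dist}^\gamma(x,[F\le\overline F])\le c_3\,\mathrm{dist}(0,\partial_PF(x))$ for all $x\in\mathfrak{B}(\overline x;\eta,\nu)$. KL property at $\overline x$ with exponent $\alpha$ on $\mathfrak{B}(\overline x;\eta,\nu)$: there is $c_1>0$ with $\mathrm{dist}(0,\partial_LF(x))\ge c_1[F(x)-\overline F]^\alpha$ for all $x\in\mathfrak{B}(\overline x;\eta,\nu)$. Bregman proximal error bound at $\overline x$: there exist $\eta,\nu,c_4>0$ with $\mathrm{dist}(x,\overline{\mathbf X}_P)\le c_4\,\mathrm{dist}(x,T_{D,\epsilon}(x))$ for all $x\in\mathfrak{B}(\overline x;\eta,\nu)$. Weak metric subregularity at $\overline x$: there exist $\eta,\nu,c_5>0$ with $c_5\,\mathrm{dist}(x,\overline{\mathbf X}_P)\le\mathrm{dist}(0,\partial_PF(x))$ for all $x\in\mathfrak{B}(\overline x;\eta,\nu)$. LPL inequality on $\mathbb{B}(\overline x;\eta)$: there is $\mu>0$ with $\frac12\|\nabla f(x)\|^2\ge\mu(f(x)-f(\overline x))$ for all $x\in\mathbb{B}(\overline x;\eta)$. $g$ is semi-convex with modulus $\rho>0$ if $g=h-\frac\rho2\|\cdot\|^2$ with $h:\mathbb{R}^n\to\mathbb{R}$ convex.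 $g$ is uniformly prox-regular around $\overline x$ with parameters $\rho\ge0,\eta>0$ if $g(x')\ge g(x)+\langle v,x'-x\rangle-\frac\rho2\|x'-x\|^2$ for all $x,x'\in\mathbb{B}(\overline x;\eta)$ and $v\in\partial_Lg(x)$. Property (A) at $x$: $F(t)\ge\overline F$ for all $t\in T_{D,\epsilon}(x)$.
   Formalization: In (ii) the modulus ρ of semi-convexity or prox-regularity must satisfy ερ < m (the claim fails otherwise), and ε̄L < m is required in the prox-regular case; ''differentiable on dom f'' means f is finite near each point of dom f. *)

(* Defs.v *)
From HB Require Import structures.
From mathcomp Require Import all_boot all_order all_algebra.
From mathcomp Require Import all_classical all_reals all_analysis.
Set Implicit Arguments.
Unset Strict Implicit.
Unset Printing Implicit Defensive.
Import Order.TTheory GRing.Theory Num.Theory.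
Import numFieldNormedType.Exports.
Local Open Scope classical_set_scope.
Local Open Scope ring_scope.

(* R^n is 'rV[R]_n.  The library norm on 'rV[R]_n is the sup norm, so the
   Euclidean inner product and norm are introduced here.  Both norms induce the
   same topology, so limits, continuity, differentiability and boundedness are
   those of the library. *)
Section Euclidean.
Context {R : realType} {n : nat}.
Implicit Types (x y : 'rV[R]_n) (A : set 'rV[R]_n).

Definition inner x y : R := \sum_(i < n) x 0 i * y 0 i.

Definition enorm x : R := Num.sqrt (inner x x).

Definition eball x (r : R) : set 'rV[R]_n := [set y | enorm (y - x) < r].

(* The infimum over the empty set is +oo. *)
Definition edist_to x A : \bar R := ereal_inf [set (enorm (x - z))%:E | z in A].

Definition grad (phi : 'rV[R]_n -> R) x : 'rV[R]_n :=
  \row_(i < n) 'D_(delta_mx 0 i) (phi : 'rV[R]_n -> R^o) x.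

Definition euclidean_lipschitz (k : R) A (phi : 'rV[R]_n -> 'rV[R]_n) : Prop :=
  forall x y, A x -> A y -> enorm (phi x - phi y) <= k * enorm (x - y).

End Euclidean.

Section ExtendedFunctions.
Context {R : realType} {n : nat}.
Implicit Types (psi : 'rV[R]_n -> \bar R) (x : 'rV[R]_n).
Local Open Scope ereal_scope.

Definition edom psi : set 'rV[R]_n := [set x | psi x < +oo].

Definition proper_fun psi : Prop :=
  (forall x, -oo < psi x) /\ edom psi !=set0.

Definition sublevel psi (a : \bar R) : set 'rV[R]_n := [set x | psi x <= a].

Definition level_bounded psi : Prop :=
  forall r : R, bounded_set (sublevel psi r%:E).

(* The first conjunct cannot be dropped: fine maps +oo to 0, so fine \o psi may
   be differentiable at a boundary point of edom psi. *)
Definition ext_differentiable psi x : Prop :=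
  (\forall y \near x, psi y \is a fin_num) /\
  differentiable (fine \o psi : 'rV[R]_n -> R^o) x.

Definition ext_grad psi x : 'rV[R]_n := grad (fine \o psi) x.

(* All subdifferentials are empty outside the effective domain. *)
Definition proximal_subdiff psi x : set 'rV[R]_n :=
  [set xi | psi x \is a fin_num /\
     exists rho' r : R, [/\ (0 < rho')%R, (0 < r)%R &
       forall y, eball x r y ->
         psi x + (inner xi (y - x) - rho' * enorm (y - x) ^+ 2)%:E <= psi y]].

Definition frechet_subdiff psi x : set 'rV[R]_n :=
  [set xi | psi x \is a fin_num /\
     forall e : R, (0 < e)%R -> \forall y \near x,
       psi x + (inner xi (y - x) - e * enorm (y - x))%:E <= psi y].

Definition limiting_subdiff psi x : set 'rV[R]_n :=
  [set xi | psi x \is a fin_num /\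
     exists u v : nat -> 'rV[R]_n,
       [/\ u k @[k --> \oo] --> x,
           psi (u k) @[k --> \oo] --> psi x,
           v k @[k --> \oo] --> xi &
           forall k, frechet_subdiff psi (u k) (v k)]].

Definition prox_critical psi : set 'rV[R]_n :=
  [set x | proximal_subdiff psi x 0%R].

Definition semi_convex psi (rho : R) : Prop :=
  (0 < rho)%R /\
  exists h : 'rV[R]_n -> R,
    convex_function [set: 'rV[R]_n] h /\
    forall x, psi x = (h x - rho / 2 * enorm x ^+ 2)%:E.

Definition uniformly_prox_regular psi x (rho eta : R) : Prop :=
  forall y y' v, eball x eta y -> eball x eta y' -> limiting_subdiff psi y v ->
    psi y + (inner v (y' - y) - rho / 2 * enorm (y' - y) ^+ 2)%:E <= psi y'.

End ExtendedFunctions.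

Section StandingAssumptions.
Context {R : realType} {n : nat}.
Implicit Types (f g psi : 'rV[R]_n -> \bar R) (K : 'rV[R]_n -> R).

Definition smooth_term f (L : R) : Prop :=
  [/\ proper_fun f, lower_semicontinuous f, convex_set (edom f),
      (forall x, edom f x -> ext_differentiable f x) &
      euclidean_lipschitz L (edom f) (ext_grad f)].

Definition nonsmooth_term g : Prop :=
  [/\ proper_fun g, lower_semicontinuous g, convex_set (edom g) &
      {within edom g, continuous g}].

Definition strongly_convex K (m : R) : Prop :=
  forall x y (t : R), 0 <= t -> t <= 1 ->
    K (t *: x + (1 - t) *: y) <=
    t * K x + (1 - t) * K y - m / 2 * t * (1 - t) * enorm (x - y) ^+ 2.

Definition bregman_kernel K (m M : R) : Prop :=
  [/\ forall x, differentiable (K : 'rV[R]_n -> R^o) x,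
      forall x, differentiable (grad K) x,
      0 < m, strongly_convex K m &
      euclidean_lipschitz M [set: 'rV[R]_n] (grad K)].

Definition bregman K (x y : 'rV[R]_n) : R := K y - (K x + inner (grad K x) (y - x)).

End StandingAssumptions.

Section BregmanProximal.
Context {R : realType} {n : nat}.
Variables (f g : 'rV[R]_n -> \bar R) (K : 'rV[R]_n -> R) (eps : R).
Local Open Scope ereal_scope.

Definition bregman_model (x y : 'rV[R]_n) : \bar R :=
  (inner (ext_grad f x) (y - x))%:E + g y + (eps^-1 * bregman K x y)%:E.

Definition bregman_prox (x : 'rV[R]_n) : set 'rV[R]_n :=
  [set y | forall z, bregman_model x y <= bregman_model x z].

Definition property_A (xbar x : 'rV[R]_n) : Prop :=
  forall t, bregman_prox x t -> f xbar + g xbar <= f t + g t.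

End BregmanProximal.

Section ErrorBounds.
Context {R : realType} {n : nat}.
Implicit Types (f F : 'rV[R]_n -> \bar R) (x xbar : 'rV[R]_n) (eta nu : R).
Local Open Scope ereal_scope.

Definition level_nbhd F xbar eta nu : set 'rV[R]_n :=
  eball xbar eta `&` [set x | F xbar < F x /\ F x < F xbar + nu%:E].

Definition level_set_subdiff_error_bound F xbar : Prop :=
  exists gamma eta nu c3 : R,
    [/\ (0 < gamma)%R, (0 < eta)%R, (0 < nu)%R, (0 < c3)%R &
      forall x, level_nbhd F xbar eta nu x ->
        edist_to x (sublevel F (F xbar)) `^ gamma <=
        c3%:E * edist_to 0%R (proximal_subdiff F x)].

Definition KL_on F xbar (alpha eta nu : R) : Prop :=
  exists c1 : R, (0 < c1)%R /\
    forall x, level_nbhd F xbar eta nu x ->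
      c1%:E * (F x - F xbar) `^ alpha <= edist_to 0%R (limiting_subdiff F x).

Definition bregman_prox_error_bound_on (f g : 'rV[R]_n -> \bar R)
    (K : 'rV[R]_n -> R) (eps : R) xbar eta nu : Prop :=
  let F := fun x => f x + g x in
  exists c4 : R, (0 < c4)%R /\
    forall x, level_nbhd F xbar eta nu x ->
      edist_to x (prox_critical F) <= c4%:E * edist_to x (bregman_prox f g K eps x).

Definition weak_metric_subregularity F xbar : Prop :=
  exists eta nu c5 : R,
    [/\ (0 < eta)%R, (0 < nu)%R, (0 < c5)%R &
      forall x, level_nbhd F xbar eta nu x ->
        c5%:E * edist_to x (prox_critical F) <= edist_to 0%R (proximal_subdiff F x)].

Definition H3 F xbar : Prop :=
  exists delta : R, (0 < delta)%R /\
    forall y, prox_critical F y -> (enorm (y - xbar) <= delta)%R ->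
      F y <= F xbar.

Definition LPL_on f xbar eta : Prop :=
  exists mu : R, (0 < mu)%R /\
    forall x, eball xbar eta x ->
      mu%:E * (f x - f xbar) <= (2^-1 * enorm (ext_grad f x) ^+ 2)%:E.

End ErrorBounds.

(* Main.v *)
Require Import Defs.
From HB Require Import structures.
From mathcomp Require Import all_boot all_order all_algebra.
From mathcomp Require Import all_classical all_reals all_analysis.
From mathcomp Require Import ring lra.
Import Order.TTheory GRing.Theory Num.Theory.
Import numFieldNormedType.Exports.
Local Open Scope classical_set_scope.
Local Open Scope ring_scope.

(** Every condition yields a lower bound on the norm of an arbitrary proximal
    subgradient [xi] of [F] at [x], and the error bound follows from it in one
    of two ways.

    Conditions (i) and (iv) give [c (F x - F xbar)^alpha <= |xi|]; in (iv) the
    only candidate for [xi] is [grad f x], and [alpha = 1/2]. It is enough to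
    show that the distance from [x] to the sublevel set [F <= F xbar] is at most
    a multiple of [(F x - F xbar)^(1 - alpha)]: eliminating [F x - F xbar] gives
    the error bound with [gamma = alpha / (1 - alpha)]. For this, let [d] be
    smaller than that distance and minimise [(F - F xbar)^(1 - alpha)] plus a
    quadratic penalty centred at [x] over the ball of radius [d]. If [d] were too
    large, the minimiser would be interior; as the power is concave, [F] would
    then have there a proximal subgradient proportional to the gradient of the
    penalty, too small for the assumed inequality
    ([radius_le_desingularised_gap]).

    Conditions (ii) and (iii) give [dist(x, X_P) <= c |xi|], where [X_P] is the
    set of critical points. By (H3) the critical points near [xbar] lie in the
    sublevel set, so the error bound holds with [gamma = 1]
    ([level_set_error_bound_of_critical]). In (iii) the inequality is the
    hypothesis. In (ii) it remains to bound the length of a Bregman step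
    [t - x] by [|xi|] ([bregman_step_le_subgradient]): [xi - grad f x] is a
    proximal subgradient of [g] at [x], the curvature hypothesis on [g] gives
    [g t >= g x + <xi - grad f x, t - x> - rho/2 |t - x|^2], and [t] does at least
    as well as [x] in the model, whose kernel is strongly convex. For a
    semi-convex [g] the minorant is global. For a prox-regular [g] it holds near
    [xbar] only, and Property (A) with the descent inequality keeps [t] there.
    Steps exist because the model is coercive.

    The descent inequality applies at any two points because [f] is finite
    everywhere ([smooth_term_fin_num]): its domain is open, and a Lipschitz
    gradient prevents [f] from growing to infinity at a boundary point. *)

Set Implicit Arguments.
Unset Strict Implicit.

(** * Euclidean geometry and lower semicontinuity *)

Section EuclideanGeometry.
Context {R : realType} {n : nat}.
Implicit Types (x y z d : 'rV[R]_n) (r t : R).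

Lemma innerC x y : inner x y = inner y x.
Proof. by apply: eq_bigr => i _; rewrite mulrC. Qed.

Lemma innerDl x y z : inner (x + y) z = inner x z + inner y z.
Proof. by rewrite -big_split; apply: eq_bigr => i _; rewrite mxE mulrDl. Qed.

Lemma innerZl t x y : inner (t *: x) y = t * inner x y.
Proof. by rewrite [RHS]mulr_sumr; apply: eq_bigr => i _; rewrite mxE mulrA. Qed.

Lemma innerNl x y : inner (- x) y = - inner x y.
Proof. by rewrite -scaleN1r innerZl mulN1r. Qed.

Lemma inner0l y : inner 0 y = 0.
Proof. by rewrite -(scale0r 0) innerZl mul0r. Qed.

Lemma innerDr x y z : inner z (x + y) = inner z x + inner z y.
Proof. by rewrite innerC innerDl !(innerC z). Qed.

Lemma innerZr t x y : inner x (t *: y) = t * inner x y.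
Proof. by rewrite innerC innerZl (innerC x). Qed.

Lemma innerNr x y : inner x (- y) = - inner x y.
Proof. by rewrite innerC innerNl (innerC x). Qed.

Lemma inner0r x : inner x 0 = 0.
Proof. by rewrite innerC inner0l. Qed.

Definition innerE := (innerDl, innerDr, innerZl, innerZr, innerNl, innerNr).

Lemma inner_self_ge0 x : 0 <= inner x x.
Proof. by apply: sumr_ge0 => i _; rewrite -expr2 sqr_ge0. Qed.

Lemma enorm_ge0 x : 0 <= enorm x.
Proof. exact: sqrtr_ge0. Qed.

Lemma enorm_sqr x : enorm x ^+ 2 = inner x x.
Proof. by rewrite sqr_sqrtr// inner_self_ge0. Qed.

Lemma enorm0 : enorm (0 : 'rV[R]_n) = 0.
Proof. by rewrite /enorm inner0l sqrtr0. Qed.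

Lemma enorm_eq0 x : enorm x = 0 -> x = 0.
Proof.
move=> x0; have : inner x x = 0 by rewrite -enorm_sqr x0 expr0n.
move/psumr_eq0P => x20; apply/rowP => i; rewrite mxE.
have /eqP := x20 (fun j _ => sqr_ge0 (x 0 j)) i isT.
by rewrite mulf_eq0 orbb => /eqP.
Qed.

Lemma enormZ t x : enorm (t *: x) = `|t| * enorm x.
Proof.
by rewrite /enorm innerZl innerZr mulrA -expr2 sqrtrM ?sqr_ge0// sqrtr_sqr.
Qed.

Lemma enormN x : enorm (- x) = enorm x.
Proof. by rewrite /enorm innerNl innerNr opprK. Qed.

Lemma enorm_distC x y : enorm (x - y) = enorm (y - x).
Proof. by rewrite -enormN opprB. Qed.

(** Cauchy-Schwarz, from the nonnegativity of the squared norm of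
    [|y|^2 x - <x, y> y]. *)
Lemma ler_inner_enorm x y : inner x y <= enorm x * enorm y.
Proof.
have [y0|yn0] := eqVneq (enorm y) 0.
  by rewrite y0 mulr0 (enorm_eq0 y0) inner0r.
have y_gt0 : 0 < enorm y by rewrite lt_def yn0 enorm_ge0.
have := inner_self_ge0 (inner y y *: x - inner x y *: y).
rewrite !innerE (innerC y x) -!enorm_sqr => h.
have {}h : 0 <= enorm y ^+ 2 * ((enorm x * enorm y) ^+ 2 - inner x y ^+ 2).
  by apply: le_trans h _; rewrite le_eqVlt; apply/orP; left; apply/eqP; ring.
move: h; rewrite pmulr_rge0 ?exprn_gt0// subr_ge0 => h.
apply: le_trans (ler_norm _) _.
by rewrite -ler_sqr ?nnegrE ?mulr_ge0 ?enorm_ge0// real_normK ?num_real.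
Qed.

Lemma enormD_le x y : enorm (x + y) <= enorm x + enorm y.
Proof.
rewrite -ler_sqr ?nnegrE ?addr_ge0 ?enorm_ge0// enorm_sqr !innerE.
rewrite (innerC y x) -!enorm_sqr; have := ler_inner_enorm x y; lra.
Qed.

Lemma enorm_triangle y x z : enorm (x - z) <= enorm (x - y) + enorm (y - z).
Proof. by rewrite -[x - z](subrKA y); exact: enormD_le. Qed.

Lemma norm_le_enorm x : `|x| <= enorm x.
Proof.
rewrite [leLHS]/Num.norm /= mx_normrE; apply/bigmax_leP; split=> [|[i j] _ /=].
  exact: enorm_ge0.
rewrite ord1 -ler_sqr ?nnegrE ?enorm_ge0// enorm_sqr real_normK ?num_real//.
rewrite /inner (bigD1 j)//= -expr2 lerDl.
by apply: sumr_ge0 => k _; rewrite -expr2 sqr_ge0.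
Qed.

Lemma continuous_inner (u v : 'rV[R]_n -> 'rV[R]_n) :
  continuous u -> continuous v -> continuous (fun z => inner (u z) (v z)).
Proof.
move=> cu cv z.
have coord (w : 'rV[R]_n -> 'rV[R]_n) i : continuous w ->
    w z' 0 i @[z' --> z] --> (w z 0 i : R).
  move=> cw; apply: (@continuous_comp _ _ _ w (fun M : 'rV[R]_n => M 0 i)).
    exact: cw.
  exact: coord_continuous.
have FF : Filter (nbhs z) by exact: nbhs_filter.
rewrite /inner; apply: (@cvg_big _ _ _ _ _ _ _ (nbhs z)) => [|i _].
  exact: add_continuous.
by apply: (@cvgM _ _ (nbhs z)); exact: coord.
Qed.

Lemma continuous_subr x : continuous (fun z : 'rV[R]_n => z - x).
Proof.
by move=> z; apply: (@cvgB _ _ _ (nbhs z)); [exact: cvg_id|exact: cvg_cst].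
Qed.

Lemma continuous_enorm_sub x : continuous (fun z => enorm (z - x)).
Proof.
move=> z; apply: (@continuous_comp _ _ _ (fun z => inner (z - x) (z - x))
  Num.sqrt); last exact: sqrt_continuous.
by apply: continuous_inner; exact: continuous_subr.
Qed.

Lemma continuous_quadratic (c q : R) (v x : 'rV[R]_n) :
  continuous (fun z => c + inner v (z - x) + q * enorm (z - x) ^+ 2).
Proof.
have sub_cont := @continuous_subr x; move=> z.
apply: (@cvgD _ _ _ (nbhs z)).
  apply: (@cvgD _ _ _ (nbhs z)); first exact: cvg_cst.
  have cst_cont : continuous (fun _ : 'rV[R]_n => v) by exact: cst_continuous.
  exact: (continuous_inner cst_cont sub_cont).
under [X in X @ _]eq_fun do rewrite enorm_sqr.
rewrite enorm_sqr; apply: (@cvgM _ _ (nbhs z)); first exact: cvg_cst.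
exact: (continuous_inner sub_cont sub_cont).
Qed.

Lemma near_eball x r : 0 < r -> \forall y \near x, eball x r y.
Proof.
move=> r0; apply: (@continuous_enorm_sub x x [set t | t < r]) => /=.
by rewrite subrr enorm0; exact: lt_nbhsl.
Qed.

Lemma compact_cball x r : compact [set y | enorm (y - x) <= r].
Proof.
apply: bounded_closed_compact.
  exists (r + `|x|); split; first exact: num_real.
  move=> M rM y /= yr; apply: le_trans (ltW rM).
  rewrite -[y](subrK x); apply: le_trans (ler_normD _ _) _.
  by rewrite lerD2r; apply: le_trans yr; exact: norm_le_enorm.
apply: (@preimage_closed _ _ (fun z => enorm (z - x)) [set t | t <= r]).
  by move=> z _; exact: continuous_enorm_sub.
exact: closed_le.
Qed.

End EuclideanGeometry.

Section Minimisation.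
Context {R : realType}.
Local Open Scope ereal_scope.

Lemma lt_real_between (u v : \bar R) : u < v -> exists a : R, u < a%:E < v.
Proof.
case: u v => [u||] [v||]// uv.
- by exists ((u + v) / 2)%R; rewrite !lte_fin !midf_lt.
- by exists (u + 1)%R; rewrite lte_fin ltrDl ltr01 ltry.
- by exists (v - 1)%R; rewrite lte_fin gtrDl ltrN10 ltNyr.
- by exists 0%R; rewrite ltNyr ltry.
Qed.

(** Lower semicontinuity relative to [A], since [(F - v) `^ b] inherits it from
    [F] only on sets where [v <= F]. *)
Definition lsc_within (T : topologicalType) (A : set T) (h : T -> \bar R) :=
  forall x (a : R), A x -> a%:E < h x -> \forall y \near x, A y -> a%:E < h y.

Lemma lower_semicontinuous_within (T : topologicalType) (A : set T)
    (h : T -> \bar R) :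
  lower_semicontinuous h -> lsc_within A h.
Proof.
move=> lsch x a _ /lsch[V Vx hV].
by apply: (@filterS _ (nbhs x) _ V) => // y Vy _; exact: hV.
Qed.

Lemma lsc_within_setT (T : topologicalType) (h : T -> \bar R) :
  lsc_within [set: T] h -> lower_semicontinuous h.
Proof.
move=> lsch x a ax; exists [set y | a%:E < h y]%E => //.
by apply: (@filterS _ (nbhs x) _ _ _ _ (lsch x a I ax)) => y; exact.
Qed.

Lemma lsc_withinD (T : topologicalType) (A : set T) (h : T -> \bar R)
    (q : T -> R) :
  lsc_within A h -> continuous q -> lsc_within A (fun x => h x + (q x)%:E).
Proof.
move=> lsch cq x a Ax; rewrite -lteBlDr// => /lt_real_between[b /andP[ab bh]].
have qx : nbhs x [set y | (a - b < q y)%R].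
  apply: (cq x [set t | (a - b < t)%R]); apply: lt_nbhsr.
  by move: ab; rewrite -EFinB lte_fin ltrBlDr -ltrBlDl.
apply: (@filterS2 _ (nbhs x) _ _ _ _ _ (lsch x b Ax bh) qx) => y hy qy Ay.
rewrite -lteBlDr// -EFinB; apply: le_lt_trans (hy Ay).
by rewrite lee_fin; move: qy => /=; lra.
Qed.

(** If the infimum [m] were not attained, the open sets [h > a], for the reals
    [a > m], would cover [A], and compactness would yield one [a > m] below [h]
    on all of [A]. *)
Lemma lsc_attains_min (T : topologicalType) (A : set T) (h : T -> \bar R) :
  compact A -> A !=set0 -> lsc_within A h ->
  exists2 c, A c & forall x, A x -> h c <= h x.
Proof.
move=> /compact_near_coveringP cA [x0 Ax0] lsch.
set m := ereal_inf (h @` A).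
have m_le x : A x -> m <= h x by move=> Ax; apply: ereal_inf_lbound; exists x.
apply: contrapT => nomin.
have m_lt x : A x -> m < h x.
  move=> Ax; rewrite lt_neqAle m_le// andbT; apply/eqP => mE.
  by apply: nomin; exists x => // y Ay; rewrite -mE m_le.
pose F := filter_from [set b : \bar R | m < b] (fun b => [set a | m < a < b]).
have FF : Filter F.
  apply: filter_from_filter; first by exists (h x0); exact: m_lt.
  move=> b c mb mc; exists (mine b c); first by rewrite /= lt_min mb.
  by move=> a /=; rewrite lt_min => /and3P[-> -> ->].
have /(cA _ F (fun a x => A x -> a < h x) FF) [b mb hb] :
    forall x, A x -> \forall x' \near x & a \near F, A x' -> a < h x'.
  move=> x Ax; have [a /andP[ma ah]] := lt_real_between (m_lt _ Ax).
  exists ([set y | A y -> a%:E < h y], [set c | m < c < a%:E]) => /=.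
    split; first exact: lsch.
    by exists a%:E.
  by move=> [y c] /= [hy /andP[_ ca]] Ay; exact: lt_trans (hy Ay).
have [a /andP[ma ab]] := lt_real_between mb.
suff : a%:E <= m by rewrite leNgt ma.
apply: le_ereal_inf_tmp => _ [x Ax <-]; apply: ltW.
by apply: (hb a%:E _ x) => //=; rewrite ma ab.
Qed.

End Minimisation.

(** * Gradients, descent and strong convexity *)

Section Gradients.
Context {R : realType} {n : nat}.
Implicit Types (phi K : 'rV[R]_n -> R) (x y d : 'rV[R]_n) (t : R).

Lemma derive_grad phi x d : differentiable (phi : 'rV[R]_n -> R^o) x ->
  'D_d (phi : 'rV[R]_n -> R^o) x = inner (grad phi x) d.
Proof.
move=> dphi; rewrite deriveE// {1}[d]row_sum_delta raddf_sum.
apply: eq_bigr => i _; rewrite mxE deriveE// mulrC; exact: linearZ.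
Qed.

Lemma is_derive_line phi x d t :
  differentiable (phi : 'rV[R]_n -> R^o) (x + t *: d) ->
  is_derive t 1 (fun s => phi (x + s *: d) : R^o) (inner (grad phi (x + t *: d)) d).
Proof.
move=> dphi.
have lineE : (fun h : R => h^-1 *: (((fun s => phi (x + s *: d) : R^o) \o shift t)
      (h *: 1) - phi (x + t *: d))) =
    (fun h : R => h^-1 *: (((phi : 'rV[R]_n -> R^o) \o shift (x + t *: d)) (h *: d)
      - phi (x + t *: d))).
  apply/funext => h /=; congr (_ *: (phi _ - _)).
  by rewrite [h *: 1]mulr1 scalerDl addrCA addrA.
apply: DeriveDef.
  by rewrite /derivable lineE; exact: diff_derivable.
by rewrite /derive lineE -derive_grad.
Qed.

(** The derivative of [t |-> phi (x + t d) - t <grad phi x, d> - L/2 |t d|^2]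
    is nonpositive. *)
Lemma descent_inequality phi (L : R) x d :
  (forall t, 0 <= t <= 1 -> differentiable (phi : 'rV[R]_n -> R^o) (x + t *: d)) ->
  (forall t, 0 <= t <= 1 ->
     enorm (grad phi (x + t *: d) - grad phi x) <= L * enorm (t *: d)) ->
  phi (x + d) <= phi x + inner (grad phi x) d + L / 2 * enorm d ^+ 2.
Proof.
move=> dphi lip.
set p := inner (grad phi x) d; set q := L / 2 * enorm d ^+ 2.
pose psi t : R := phi (x + t *: d) - t * p - t ^+ 2 * q.
pose dpsi t : R := inner (grad phi (x + t *: d)) d - p - (t *+ 2) * q.
have psi' t : 0 <= t <= 1 -> is_derive t 1 psi (dpsi t).
  move=> t01; have lin := is_derive_line (dphi _ t01).
  have -> : psi = (fun s => phi (x + s *: d) : R^o) - p *: (@id R)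
      - q *: ((@id R) ^+ 2).
    by apply/funext => s; rewrite /psi !fctE /=; congr (_ - _ - _); rewrite mulrC.
  apply: is_derive_eq.
  have scaleE (a b : R) : a *: (b : R^o) = a * b by [].
  rewrite /dpsi /= !scaleE; ring.
have psi_cont : {within `[0, 1], continuous psi}.
  apply: derivable_within_continuous => t; rewrite in_itv /= => t01.
  exact: (@ex_derive _ _ _ _ _ _ _ (psi' t t01)).
have psi'_oo t : t \in `]0, 1[ -> is_derive t 1 psi (dpsi t).
  by rewrite in_itv /= => /andP[t0 t1]; apply: psi'; rewrite !ltW.
have [c] := MVT ltr01 psi'_oo psi_cont.
rewrite in_itv /= => /andP[c0 c1]; rewrite /psi /dpsi scale1r scale0r addr0.
have : inner (grad phi (x + c *: d) - grad phi x) d <= L * c * enorm d ^+ 2.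
  apply: le_trans (ler_inner_enorm _ _) _; rewrite expr2 mulrA.
  apply: ler_wpM2r; first exact: enorm_ge0.
  apply: le_trans (lip c _) _; first by rewrite !ltW.
  by rewrite enormZ (ger0_norm (ltW c0)) mulrA.
rewrite innerDl innerNl -/p /q => h1 h2; lra.
Qed.

(** The limit [t -> 0+] of the strong convexity inequality on
    [x + t (y - x)], divided by [t]. *)
Lemma strongly_convex_bregman_ge K (m : R) x y :
  differentiable (K : 'rV[R]_n -> R^o) x -> strongly_convex K m ->
  m / 2 * enorm (y - x) ^+ 2 <= bregman K x y.
Proof.
move=> dK scK; set d := y - x.
have cvgK : (fun h : R =>
    h^-1 *: (((K : 'rV[R]_n -> R^o) \o shift x) (h *: d) - K x))
    @ 0^'+ --> (inner (grad K x) d : R^o).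
  apply: cvg_dnbhs_at_right; rewrite -derive_grad//; exact: diff_derivable.
have cvgU : (fun h : R => K y - K x - m / 2 * (1 - h) * enorm d ^+ 2)
    @ 0^'+ --> K y - K x - m / 2 * enorm d ^+ 2.
  rewrite -{2}[m / 2]mulr1 -[X in _ * X * _](subr0 1).
  apply: cvg_at_right_filter.
  apply: cvgB; first exact: cvg_cst.
  apply: cvgM; last exact: cvg_cst.
  apply: cvgM; first exact: cvg_cst.
  by apply: cvgB; [exact: cvg_cst|exact: cvg_id].
have := ler_cvg_to cvgK cvgU.
rewrite /bregman => h; suff : inner (grad K x) d <= K y - K x - m / 2 * enorm d ^+ 2.
  rewrite /d; lra.
apply: h; near=> h.
have h0 : 0 < h by [].
have h1 : h <= 1 by near: h; apply: nbhs_right_le.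
have := scK y x h (ltW h0) h1.
have -> : h *: y + (1 - h) *: x = h *: d + x.
  by rewrite /d scalerBr scalerBl scale1r addrA addrAC.
rewrite -/d => hK /=.
rewrite -[_ *: _]/(_ * _) -ler_pdivlMl ?invr_gt0// invrK.
apply: le_trans (lerB hK (lexx (K x))) _.
by rewrite le_eqVlt; apply/orP; left; apply/eqP; ring.
Unshelve. all: by end_near.
Qed.

End Gradients.

(** * Subdifferentials and the smooth term *)

Section Subdifferentials.
Context {R : realType} {n : nat}.
Implicit Types (psi : 'rV[R]_n -> \bar R) (x y xi : 'rV[R]_n).

Lemma proximal_sub_frechet psi x :
  proximal_subdiff psi x `<=` frechet_subdiff psi x.
Proof.
move=> xi [fx [rho [r [rho0 r0 hxi]]]]; split=> // e e0.
have er0 : 0 < Num.min r (e / rho) by rewrite lt_min r0 divr_gt0.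
apply: filterS (near_eball x er0) => y.
rewrite /eball /= lt_min => /andP[yr ye].
apply: le_trans (hxi y yr); rewrite leeD2l// lee_fin lerD2l lerN2 expr2 mulrA.
by apply: ler_wpM2r; [exact: enorm_ge0|rewrite mulrC -ler_pdivlMr// ltW].
Qed.

Lemma frechet_sub_limiting psi x :
  frechet_subdiff psi x `<=` limiting_subdiff psi x.
Proof.
move=> xi [fx hxi]; split=> //; exists (fun=> x), (fun=> xi).
by split=> //; exact: cvg_cst.
Qed.

Lemma proximal_sub_limiting psi x :
  proximal_subdiff psi x `<=` limiting_subdiff psi x.
Proof. by move=> xi /proximal_sub_frechet /frechet_sub_limiting. Qed.

End Subdifferentials.

Section SmoothTerm.
Context {R : realType} {n : nat}.
Implicit Types (f g : 'rV[R]_n -> \bar R) (x y xi : 'rV[R]_n) (L t : R).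

Lemma convex_set_segment (A : set 'rV[R]_n) x y t :
  convex_set A -> A x -> A y -> 0 <= t <= 1 -> A (x + t *: (y - x)).
Proof.
move=> cA Ax Ay /andP[t0 t1].
have := cA y x (Itv01 t0 t1) (mem_set Ay) (mem_set Ax); rewrite inE.
by congr (A _); rewrite /conv /= scalerBl scale1r scalerBr addrCA.
Qed.

Lemma smooth_term_descent f L x y : smooth_term f L -> edom f x -> edom f y ->
  fine (f y) <= fine (f x) + inner (ext_grad f x) (y - x)
                + L / 2 * enorm (y - x) ^+ 2.
Proof.
move=> [_ _ cvx_dom df lip] fx fy.
have seg t : 0 <= t <= 1 -> edom f (x + t *: (y - x)).
  exact: convex_set_segment.
rewrite -[in fine (f y)](subrKC x y).
apply: (@descent_inequality _ _ (fine \o f)) => t t01.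
  by have [] := df _ (seg t t01).
have := lip _ _ (seg t t01) fx.
by rewrite [x + _ - x]addrC addKr.
Qed.

(** The domain is open because [f] is finite near each of its points. It is
    closed as well: on its domain [f] lies below the continuous quadratic of
    the descent inequality, whereas lower semicontinuity makes [f] exceed any
    real near a point where it is infinite. *)
Lemma smooth_term_fin_num f L x : smooth_term f L -> f x \is a fin_num.
Proof.
move=> sf; have [[fNy [x0 fx0]] lscf _ df _] := sf.
suff -> : f x \is a fin_num = (f x < +oo)%E.
  pose line t := x0 + t *: (x - x0).
  have line_cont : continuous line.
    move=> t; apply: (@cvgD _ _ _ (nbhs t)); first exact: cvg_cst.
    exact: (@scalel_continuous R 'rV[R]_n (x - x0) t).
  have cR : connected [set: R] by apply/connected_intervalP.
  have BT : line @^-1` edom f = [set: R].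
    apply: cR.
    - by exists 0; rewrite /line /= scale0r addr0.
    - exists (line @^-1` edom f); last by rewrite setTI.
      apply: open_comp => [t _|]; first exact: line_cont.
      rewrite openE => z fz; have [nf _] := df z fz.
      by apply: filterS nf => y fy; rewrite /edom /= ltey_eq fy.
    - exists (line @^-1` edom f); last by rewrite setTI.
      apply: preimage_closed => [t _|]; first exact: line_cont.
      move=> z cz; apply: contrapT => fz.
      have {}fz : f z = +oo%E by apply/eqP; rewrite -leye_eq leNgt; apply/negP.
      pose q y := fine (f x0) + inner (ext_grad f x0) (y - x0)
                  + L / 2 * enorm (y - x0) ^+ 2.
      have q_cont : continuous q by exact: continuous_quadratic.
      have q_lt : ((q z + 1)%:E < f z)%E by rewrite fz ltry.
      have [V Vz hV] := lscf z (q z + 1) q_lt.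
      have Wz : nbhs z (V `&` [set y | q y < q z + 1]).
        apply: filterI => //; apply: (q_cont z [set t | t < q z + 1]) => /=.
        by apply: lt_nbhsl; rewrite ltrDl.
      have [y [fy [/hV Vy qy]]] := cz _ Wz.
      have := smooth_term_descent sf fx0 fy; rewrite -/(q y) => fyq.
      move: Vy; rewrite -[f y]fineK; last by rewrite fin_real// fNy.
      by rewrite lte_fin ltNge (le_trans fyq (ltW qy)).
  have : (line @^-1` edom f) 1 by rewrite BT.
  by rewrite /line /= scale1r subrKC.
by rewrite fin_numElt fNy.
Qed.

(** The quadratic minorant of [f + g] at [x] loses at most the quadratic
    majorant of [f] given by the descent inequality. *)
Lemma proximal_subdiff_subr f g L x xi :
  smooth_term f L ->
  proximal_subdiff (fun y => f y + g y)%E x xi ->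
  proximal_subdiff g x (xi - ext_grad f x).
Proof.
move=> sf [fgx [rho [r [rho0 r0 hxi]]]].
have ff y : f y = (fine (f y))%:E by rewrite fineK// (smooth_term_fin_num _ sf).
have gx : g x \is a fin_num.
  by move: fgx; rewrite ff; case: (g x).
split=> //; exists (rho + `|L| / 2), r; split=> //.
  by rewrite ltr_wpDr ?divr_ge0.
move=> y yr; have := hxi y yr; rewrite (ff x) (ff y) -(fineK gx).
rewrite -!EFinD.
case: (g y) => [b||]//=.
  rewrite -!EFinD !lee_fin innerDl innerNl.
  have := smooth_term_descent sf (x := x) (y := y).
  rewrite /edom /= (ff x) (ff y) !ltry => /(_ isT isT) /=.
  have : L / 2 * enorm (y - x) ^+ 2 <= `|L| / 2 * enorm (y - x) ^+ 2.
    by rewrite ler_wpM2r ?sqr_ge0// ler_pM2r// ler_norm.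
  lra.
by move=> _; exact: leey.
Qed.

End SmoothTerm.

(** * Error bounds from the Kurdyka-Lojasiewicz inequality *)

Section Powers.
Context {R : realType}.
Implicit Types a b s t : R.

Lemma powRD_gt0 s a b : 0 < s -> s `^ (a + b) = s `^ a * s `^ b.
Proof. by move=> s0; rewrite powRD// (gt_eqF s0) implybT. Qed.

(** Weighted arithmetic-geometric inequality
    [t^b s^(1-b) <= b t + (1-b) s], divided by [s^(1-b)]. *)
Lemma powR_le_tangent b s t : 0 < b < 1 -> 0 < s -> 0 <= t ->
  t `^ b <= s `^ b + b * s `^ (b - 1) * (t - s).
Proof.
move=> /andP[b0 b1] s0 t0.
have sb0 : 0 < s `^ (1 - b) by exact: powR_gt0.
have s1 : s `^ (b - 1) * s `^ (1 - b) = 1.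
  by rewrite -powRD_gt0// subrKA subrr powRr0.
have sE : s `^ b * s `^ (1 - b) = s.
  by rewrite -powRD_gt0// subrKC powRr1// ltW.
have := @conjugate_powR R (t `^ b) (s `^ (1 - b)) b^-1 (1 - b)^-1.
rewrite !powR_ge0 !invr_gt0 b0 subr_gt0 b1 !invrK subrKC -!powRrM.
rewrite !divff ?gt_eqF ?subr_gt0// (powRr1 t0) (powRr1 (ltW s0)) =>
  /(_ isT isT isT isT erefl) h.
rewrite -(ler_pM2r sb0) mulrDl sE.
have -> : b * s `^ (b - 1) * (t - s) * s `^ (1 - b) =
   b * (t - s) * (s `^ (b - 1) * s `^ (1 - b)) by ring.
rewrite s1; lra.
Qed.

Lemma lt_poweR_root b a (t : \bar R) : 0 < b -> 0 <= a -> (0 <= t)%E ->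
  (a%:E < t `^ b)%E = ((a `^ b^-1)%:E < t)%E.
Proof.
move=> b0 a0; case: t => [t||]// t0; last by rewrite poweRyr ?gt_eqF// !ltry.
rewrite poweR_EFin !lte_fin; move: t0; rewrite lee_fin => t0.
rewrite -[in LHS](powRr1 a0) -[in LHS](mulVf (lt0r_neq0 b0)) powRrM.
apply/idP/idP; last by apply: gt0_ltr_powR; rewrite ?nnegrE ?powR_ge0.
apply: contraTT; rewrite -!leNgt; apply: ge0_ler_powR; rewrite ?nnegrE ?powR_ge0//.
exact: ltW.
Qed.

Lemma lsc_within_poweR (T : topologicalType) (F : T -> \bar R) (A : set T)
    (v b : R) :
  lower_semicontinuous F -> 0 < b ->
  (forall z, A z -> (v%:E <= F z)%E) ->
  lsc_within A (fun z => (F z - v%:E) `^ b)%E.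
Proof.
move=> lscF b0 vF z a Az.
have [a0|a0] := ltP a 0.
  move=> _; apply: nearW => y _; apply: lt_le_trans (poweR_ge0 _ _).
  by rewrite lte_fin.
rewrite lt_poweR_root ?sube_ge0 ?vF// lteBrDr// -EFinD => /lscF[V Vz hV].
apply: (@filterS _ (nbhs z) _ V) => // y /hV vy Ay.
by rewrite lt_poweR_root ?sube_ge0 ?vF// lteBrDr// -EFinD.
Qed.

End Powers.

Section KurdykaLojasiewicz.
Context {R : realType} {n : nat}.
Implicit Types (F : 'rV[R]_n -> \bar R) (x y z xi : 'rV[R]_n).

(** If the conclusion fails, a minimiser [y] of [(F - v)^b + k |. - x|^2] over the
    ball is interior: on the boundary the penalty alone, [k d^2 = b c d / 2],
    exceeds the value at [x]. Concavity of the power then turns minimality into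
    a quadratic minorant of [F] at [y], whose slope is proportional to [y - x]
    and violates the lower bound assumed on subgradients. *)
Lemma radius_le_desingularised_gap F x (v b c d : R) :
  lower_semicontinuous F -> 0 < b < 1 -> 0 < c -> 0 < d ->
  F x \is a fin_num ->
  (forall z, enorm (z - x) <= d -> (v%:E < F z)%E) ->
  (forall y xi, enorm (y - x) < d -> (F y <= F x)%E -> proximal_subdiff F y xi ->
     c * (fine (F y) - v) `^ (1 - b) <= enorm xi) ->
  b * c * d / 2 <= (fine (F x) - v) `^ b.
Proof.
move=> lscF b01 c0 d0 Fx vF slope; have /andP[b0 b1] := b01.
rewrite leNgt; apply/negP => gap.
(* The largest weight for which the slope at an interior minimiser stays below
   the assumed bound. *)
set k := b * c / (2 * d).
have k0 : 0 < k by rewrite divr_gt0 ?mulr_gt0.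
have kd : k * d ^+ 2 = b * c * d / 2 by rewrite /k; field; lra.
pose h z := ((F z - v%:E) `^ b + (k * enorm (z - x) ^+ 2)%:E)%E.
have [||y yd ymin] := @lsc_attains_min R _ _ h (@compact_cball R n x d).
- by exists x; rewrite /= subrr enorm0 ltW.
- apply: lsc_withinD; first by apply: lsc_within_poweR => // z /vF /ltW.
  have := @continuous_quadratic R n 0 k 0 x.
  by under eq_fun do rewrite inner0l !add0r.
have hx : h x = ((fine (F x) - v) `^ b)%:E.
  rewrite /h subrr enorm0 expr0n mulr0 adde0.
  by rewrite -[in LHS](fineK Fx) -EFinB poweR_EFin.
have hyx : (h y <= ((fine (F x) - v) `^ b)%:E)%E.
  by rewrite -hx; apply: ymin; rewrite /= subrr enorm0 ltW.
have Fy : F y \is a fin_num.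
  rewrite fin_numElt (lt_trans (ltNyr v) (vF _ yd)) /= ltey; apply/eqP => Fy.
  by move: hyx; rewrite /h Fy addye// poweRyr ?gt_eqF// leye_eq.
set s := fine (F y) - v.
have s0 : 0 < s by rewrite subr_gt0 -lte_fin fineK// vF.
have hy : h y = (s `^ b + k * enorm (y - x) ^+ 2)%:E.
  by rewrite /h -[in LHS](fineK Fy) -EFinB poweR_EFin -EFinD.
move: hyx; rewrite hy lee_fin => hyx.
have sb_ge0 := powR_ge0 s b.
have yd' : enorm (y - x) < d.
  rewrite -ltr_sqr ?nnegrE ?enorm_ge0 ?ltW//.
  by rewrite -(ltr_pM2l k0) kd; lra.
have yFx : (F y <= F x)%E.
  rewrite -(fineK Fx) -(fineK Fy) lee_fin -(lerD2r (- v)) leNgt; apply/negP => xy.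
  have x0 : 0 <= fine (F x) - v.
    by rewrite subr_ge0 -lee_fin fineK// ltW// vF// subrr enorm0 ltW.
  have := @gt0_ltr_powR R b b0 (fine (F x) - v) s x0 (ltW s0) xy.
  have : 0 <= k * enorm (y - x) ^+ 2 by rewrite mulr_ge0 ?sqr_ge0// ltW.
  lra.
set w := b * s `^ (b - 1).
have w0 : 0 < w by rewrite mulr_gt0 ?powR_gt0.
have sub_y : proximal_subdiff F y (- (2 * k / w) *: (y - x)).
  split=> //; exists (k / w), (d - enorm (y - x)).
  split; [exact: divr_gt0|by rewrite subr_gt0|move=> z zy].
  have zd : enorm (z - x) <= d.
    by have := enorm_triangle y z x; move: zy; rewrite /eball /=; lra.
  have := ymin z zd; rewrite hy /h; have := vF z zd.
  rewrite -(fineK Fy); case: (F z) => [t||]//; last by rewrite leey.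
  rewrite lte_fin -EFinB poweR_EFin -!EFinD !lee_fin => vt.
  have := powR_le_tangent b01 s0 (_ : 0 <= t - v); rewrite subr_ge0 ltW// => /(_ isT).
  rewrite -/w.
  have -> : enorm (z - x) ^+ 2 =
      enorm (z - y) ^+ 2 + 2 * inner (y - x) (z - y) + enorm (y - x) ^+ 2.
    rewrite -[z - x](subrKA y) !enorm_sqr !innerDl !innerDr !innerNl !innerNr.
    rewrite (innerC y z) (innerC x z) (innerC x y); ring.
  rewrite innerZl => h1 h2.
  rewrite -lerBrDl -(ler_pM2l w0).
  have -> : w * (- (2 * k / w) * inner (y - x) (z - y)
       - k / w * enorm (z - y) ^+ 2) =
      - (2 * k * inner (y - x) (z - y)) - k * enorm (z - y) ^+ 2.
    by field; lra.
  rewrite /s in h1 h2 *; lra.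
have := slope _ _ yd' yFx sub_y.
rewrite leNgt => /negP; apply; rewrite -/s enormZ normrN.
have -> : `|2 * k / w| = 2 * k / w by rewrite gtr0_norm// divr_gt0// mulr_gt0.
rewrite mulrAC ltr_pdivrMr//.
have -> : c * s `^ (1 - b) * w = 2 * k * d.
  have -> : c * s `^ (1 - b) * w = c * b * (s `^ (1 - b) * s `^ (b - 1)).
    by rewrite /w; ring.
  rewrite -powRD_gt0// subrKA subrr powRr0 /k; field; lra.
by rewrite ltr_pM2l// mulr_gt0.
Qed.

End KurdykaLojasiewicz.

Section Distances.
Context {R : realType} {n : nat}.
Implicit Types (x z : 'rV[R]_n) (A : set 'rV[R]_n).
Local Open Scope ereal_scope.

Lemma edist_to_le x z A : A z -> edist_to x A <= (enorm (x - z))%:E.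
Proof. by move=> Az; apply: ereal_inf_lbound; exists z. Qed.

Lemma le_edist_to x A (a : \bar R) :
  (forall z, A z -> a <= (enorm (x - z))%:E) -> a <= edist_to x A.
Proof. by move=> h; apply: le_ereal_inf_tmp => _ [z Az <-]; exact: h. Qed.

Lemma edist_to_ge0 x A : 0 <= edist_to x A.
Proof. by apply: le_edist_to => z _; rewrite lee_fin enorm_ge0. Qed.

Lemma le_mul_edist0 (c : R) (a : \bar R) A : (0 < c)%R ->
  (forall xi, A xi -> a <= (c * enorm xi)%:E) -> a <= c%:E * edist_to 0 A.
Proof.
move=> c0 h; rewrite -lee_pdivrMl//; apply: le_edist_to => xi Axi.
by rewrite lee_pdivrMl// -EFinM sub0r enormN; exact: h.
Qed.

End Distances.

Section LevelSetErrorBound.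
Context {R : realType} {n : nat}.
Implicit Types (F : 'rV[R]_n -> \bar R) (x z xi xbar : 'rV[R]_n).

Lemma level_nbhd_fin_num F xbar eta nu x : F xbar \is a fin_num ->
  level_nbhd F xbar eta nu x -> F x \is a fin_num.
Proof.
move=> Fxbar [_ [lo hi]]; rewrite fin_numElt.
rewrite (le_lt_trans (leNye _) lo) (lt_trans hi)//.
by rewrite -(fineK Fxbar) -EFinD ltry.
Qed.

(** The distance to the sublevel set is at most a multiple of the gap
    [F x - F xbar] to the power [b = 1 - alpha], and the assumed inequality
    bounds the gap to the power [alpha]; the exponent [alpha / b] lets the gap
    cancel. *)
Lemma level_set_error_bound_of_KL F xbar (alpha eta nu c : R) :
  lower_semicontinuous F -> F xbar \is a fin_num ->
  0 < alpha < 1 -> 0 < eta -> 0 < nu -> 0 < c ->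
  (forall x xi, level_nbhd F xbar eta nu x -> proximal_subdiff F x xi ->
     c * (fine (F x) - fine (F xbar)) `^ alpha <= enorm xi) ->
  level_set_subdiff_error_bound F xbar.
Proof.
move=> lscF Fxbar /andP[alpha0 alpha1] eta0 nu0 c0 KL.
set v := fine (F xbar).
have vE : v%:E = F xbar by rewrite /v fineK.
pose b := 1 - alpha.
have b0 : 0 < b by rewrite /b; lra.
have b01 : 0 < b < 1 by rewrite b0 /b; lra.
pose gamma := alpha / b.
have gamma0 : 0 < gamma by rewrite divr_gt0.
pose C := 2 / (b * c).
have C0 : 0 < C by rewrite divr_gt0 ?mulr_gt0.
exists gamma, (eta / 2), nu, (C `^ gamma / c).
split=> //; [lra|by rewrite divr_gt0 ?powR_gt0|].
move=> x [xeta [lo hi]].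
have xin : level_nbhd F xbar eta nu x.
  by split=> //; move: xeta; rewrite /eball /=; lra.
have Fx := level_nbhd_fin_num Fxbar xin.
set s := fine (F x) - v.
have s0 : 0 < s by rewrite subr_gt0 -lte_fin /v !fineK.
set S := sublevel F (F xbar).
have dist_le_norm : (edist_to x S <= (enorm (x - xbar))%:E)%E.
  by apply: edist_to_le; rewrite /S /sublevel /=.
(* As [xbar] lies in the sublevel set, a radius [d] below the distance is below
   [eta / 2], so the ball of radius [d] around [x] stays in that of radius [eta]
   around [xbar]. *)
have dist_le : (edist_to x S <= (C * s `^ b)%:E)%E.
  rewrite leNgt; apply/negP => /lt_real_between[d /andP[Cd dS]].
  move: Cd; rewrite lte_fin => Cd.
  have d0 : 0 < d.
    by apply: le_lt_trans Cd; rewrite mulr_ge0 ?powR_ge0 ?ltW.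
  have d_eta : d < eta / 2.
    rewrite -lte_fin; apply: lt_le_trans dS _; apply: le_trans dist_le_norm _.
    by rewrite lee_fin ltW.
  have := @radius_le_desingularised_gap _ _ F x v b c d lscF b01 c0 d0 Fx.
  have -> : 1 - b = alpha by rewrite /b; lra.
  suff h : b * c * d / 2 > s `^ b.
    rewrite leNgt h => /(_ _ _)/negP; apply => //.
      move=> z zd; rewrite vE ltNge; apply/negP => zS.
      have := lt_le_trans dS (edist_to_le x (zS : S z)).
      by rewrite lte_fin enorm_distC ltNge zd.
    move=> y xi yd yx sub_y.
    have [vy|yv] := ltP (F xbar) (F y).
      apply: KL => //; split; last first.
        by split=> //; exact: le_lt_trans yx hi.
      rewrite /eball /=; have := enorm_triangle x y xbar.
      move: xeta; rewrite /eball /=; lra.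
    have := lt_le_trans dS (edist_to_le x (yv : S y)).
    by rewrite lte_fin enorm_distC ltNge ltW.
  have : b * c / 2 * (C * s `^ b) < b * c / 2 * d.
    by rewrite ltr_pM2l// divr_gt0 ?mulr_gt0.
  have -> : b * c / 2 * (C * s `^ b) = s `^ b by rewrite /C; field; lra.
  lra.
apply: le_mul_edist0 => [|xi sub_x]; first by rewrite divr_gt0 ?powR_gt0.
have sE : (C * s `^ b) `^ gamma = C `^ gamma * s `^ alpha.
  rewrite powRM ?powR_ge0 ?ltW// -powRrM.
  by have -> : b * gamma = alpha by rewrite /gamma; field; lra.
apply: (@le_trans _ _ ((C * s `^ b)%:E `^ gamma)%E).
  apply: gt0_ler_poweR => //; rewrite ?in_itv /= ?leey ?andbT ?edist_to_ge0//.
    exact: ltW.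
  by rewrite lee_fin mulr_ge0 ?powR_ge0// ltW.
rewrite poweR_EFin lee_fin sE -mulrA ler_pM2l ?powR_gt0//.
by rewrite ler_pdivlMl//; exact: KL xin sub_x.
Qed.

(** Condition (H3) puts the critical points near [xbar] in the sublevel set,
    and [xbar] itself is closer to [x] than any other critical point. *)
Lemma edist_sublevel_le_critical F xbar (delta : R) x :
  (forall y, prox_critical F y -> enorm (y - xbar) <= delta ->
     (F y <= F xbar)%E) ->
  enorm (x - xbar) < delta / 2 ->
  (edist_to x (sublevel F (F xbar)) <= edist_to x (prox_critical F))%E.
Proof.
move=> h3 xd; apply: le_edist_to => z zc.
have [zx|xz] := leP (enorm (x - z)) (enorm (x - xbar)).
  apply: edist_to_le; apply: h3 => //.
  have := enorm_triangle x z xbar; rewrite (enorm_distC z x); lra.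
apply: le_trans (edist_to_le _ _) _; first exact: (lexx (F xbar)).
by rewrite lee_fin ltW.
Qed.

Lemma level_set_error_bound_of_critical F xbar (eta nu c : R) :
  0 < eta -> 0 < nu -> 0 < c -> H3 F xbar ->
  (forall x xi, level_nbhd F xbar eta nu x -> proximal_subdiff F x xi ->
     (edist_to x (prox_critical F) <= (c * enorm xi)%:E)%E) ->
  level_set_subdiff_error_bound F xbar.
Proof.
move=> eta0 nu0 c0 [delta [delta0 h3]] hc.
exists 1, (Num.min eta (delta / 2)), nu, c.
split=> //; first by rewrite lt_min eta0 divr_gt0.
move=> x []; rewrite /eball /= lt_min => /andP[xeta xdelta] lohi.
rewrite poweRe1 ?edist_to_ge0//.
apply: le_mul_edist0 => // xi sub_x.
by apply: le_trans (edist_sublevel_le_critical h3 xdelta) _; exact: hc.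
Qed.

End LevelSetErrorBound.

(** * The composite objective *)

Section CompositeFunction.
Context {R : realType} {n : nat}.
Implicit Types (f g F : 'rV[R]_n -> \bar R) (x y v xi : 'rV[R]_n).

Lemma lower_semicontinuous_sum f g L :
  smooth_term f L -> lower_semicontinuous g ->
  lower_semicontinuous (fun x => f x + g x)%E.
Proof.
move=> sf lscg; have fE x := fineK (smooth_term_fin_num x sf).
rewrite [X in lower_semicontinuous X](_ : _ = fun x => (g x + (fine (f x))%:E)%E);
  last by apply/funext => x; rewrite addeC fE.
apply/lsc_within_setT/lsc_withinD; first exact: lower_semicontinuous_within.
move=> x; have [_ _ _ df _] := sf.
have [|_ dfx] := df x; first by rewrite /edom /= -fE ltry.
exact: differentiable_continuous dfx.
Qed.

(** The sublevel set through [x] is compact, so [F] attains its minimum there. *)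
Lemma level_bounded_lower_bound F x :
  lower_semicontinuous F -> level_bounded F -> (forall y, (-oo < F y)%E) ->
  F x \is a fin_num -> exists B : R, forall y, (B%:E <= F y)%E.
Proof.
move=> lscF lbF FNy Fx; pose A := sublevel F (F x).
have cA : compact A.
  apply: bounded_closed_compact; first by have := lbF (fine (F x)); rewrite fineK.
  have -> : A = ~` [set y | ((fine (F x))%:E < F y)%E].
    by apply/seteqP; split=> y; rewrite /A /sublevel /= fineK// leNgt => /negP.
  by apply: open_closedC; move/lower_semicontinuousP : lscF; exact.
have [||c Ac cmin] := @lsc_attains_min R _ A F cA.
- by exists x; exact: (lexx (F x)).
- exact: lower_semicontinuous_within.
have Fc : F c \is a fin_num.
  rewrite fin_numElt FNy (le_lt_trans (Ac : (F c <= F x)%E))//.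
  by rewrite -(fineK Fx) ltry.
exists (fine (F c)) => y; rewrite fineK//.
have [yA|yA] := leP (F y) (F x); first exact: cmin.
exact: le_trans (cmin x (lexx (F x))) (ltW yA).
Qed.

(** Adding [rho / 2 |.|^2] makes [g] convex, so that a local quadratic minorant,
    tested at [x + s (y - x)] with [s] small, extends to the whole segment with
    its curvature replaced by [rho]. *)
Lemma semi_convex_subgradient g (rho : R) x y v :
  semi_convex g rho -> proximal_subdiff g x v ->
  (g x + (inner v (y - x) - rho / 2 * enorm (y - x) ^+ 2)%:E <= g y)%E.
Proof.
move=> [rho0 [h [cvx_h gE]]] [_ [r' [r [r'0 r0 hv]]]].
set d := y - x; rewrite !gE -EFinD lee_fin; apply/ler_addgt0Pr => e e0.
set D := enorm d ^+ 2 + enorm d + 1.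
have d_ge0 := enorm_ge0 d; have d2_ge0 := sqr_ge0 (enorm d).
have D0 : 0 < D by rewrite /D; lra.
pose s := Num.min 1 (Num.min (r / (2 * D)) (e / (r' * D))).
have s0 : 0 < s by rewrite !lt_min ltr01 !divr_gt0 ?mulr_gt0.
have s1 : s <= 1 by rewrite ge_min lexx.
have sr : s * D <= r / 2.
  have -> : r / 2 = r / (2 * D) * D by field; lra.
  by rewrite ler_pM2r// !ge_min lexx orbT.
have se : r' * (s * D) <= e.
  have -> : e = r' * (e / (r' * D) * D) by field; lra.
  by rewrite ler_pM2l// ler_pM2r// !ge_min lexx !orbT.
have sd : enorm ((x + s *: d) - x) = s * enorm d.
  by rewrite [x + _]addrC addrK enormZ gtr0_norm.
have xs : eball x r (x + s *: d).
  rewrite /eball /= sd.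
  have : s * enorm d <= s * D by rewrite ler_pM2l// /D; lra.
  lra.
have := hv _ xs.
rewrite !gE -EFinD lee_fin sd [x + _ - x]addrC addKr innerZr => hxs.
have := cvx_h (Itv01 (ltW s0) s1) y x (in_setT _) (in_setT _).
have -> : (conv (Itv01 (ltW s0) s1) (y : convex_lmodType _) x) = x + s *: d.
  by rewrite /conv /= /d scalerBl scale1r scalerBr addrCA.
rewrite convRE /= => hcvx.
have nE : enorm (x + s *: d) ^+ 2 =
    s * enorm y ^+ 2 + (1 - s) * enorm x ^+ 2 - s * (1 - s) * enorm d ^+ 2.
  rewrite !enorm_sqr /d !innerE (innerC y x); ring.
rewrite nE in hxs.
rewrite -(ler_pM2l s0).
have hsD : s * (r' * (s * enorm d ^+ 2)) <= s * e.
  rewrite ler_pM2l//; apply: le_trans se; rewrite !ler_pM2l// /D; lra.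
have hss : 0 <= rho / 2 * (s * s * enorm d ^+ 2).
  by apply: mulr_ge0; [lra|rewrite mulr_ge0// -expr2 sqr_ge0].
rewrite /unstable.onem in hcvx.
lra.
Qed.

End CompositeFunction.

(** * Bregman proximal steps *)

Section BregmanSteps.
Context {R : realType} {n : nat}.
Variables (f g : 'rV[R]_n -> \bar R) (K : 'rV[R]_n -> R) (L m M eps : R).
Hypotheses (sf : smooth_term f L) (hK : bregman_kernel K m M) (eps0 : 0 < eps).
Implicit Types (x y t xi : 'rV[R]_n).

Lemma bregman_model_id x : bregman_model f g K eps x x = g x.
Proof.
by rewrite /bregman_model /bregman subrr !inner0r addr0 subrr mulr0 add0e adde0.
Qed.

Lemma bregman_model_ge x y (a : R) : (a%:E <= g y)%E ->
  ((inner (ext_grad f x) (y - x) + a + m / (2 * eps) * enorm (y - x) ^+ 2)%:E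
    <= bregman_model f g K eps x y)%E.
Proof.
move=> ay; have [dK _ _ scK _] := hK.
rewrite /bregman_model !EFinD; apply: leeD; first by rewrite leeD2l.
rewrite lee_fin ler_pdivlMl//.
have := strongly_convex_bregman_ge y (dK x) scK.
have -> : eps * (m / (2 * eps) * enorm (y - x) ^+ 2) = m / 2 * enorm (y - x) ^+ 2.
  by field; exact: lt0r_neq0.
by [].
Qed.

Lemma bregman_prox_nonempty x (a b c : R) :
  lower_semicontinuous g -> 0 <= a -> 0 <= b -> 0 < c ->
  (forall y, (g x - (a + b * enorm (y - x) - c * enorm (y - x) ^+ 2)%:E
    <= bregman_model f g K eps x y)%E) ->
  bregman_prox f g K eps x !=set0.
Proof.
move=> lscg a0 b0 c0 coercive; have [dK _ _ _ _] := hK.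
(* Beyond the radius [r] the model exceeds its value [g x] at [x], because
   [c e^2 >= (a + b) e >= a + b e] for [e >= r]. *)
pose r := 1 + (a + b) / c.
have r1 : 1 <= r by rewrite lerDl divr_ge0 ?addr_ge0// ltW.
pose q0 y := - (eps^-1 * K x)
  + inner (ext_grad f x - eps^-1 *: grad K x) (y - x) + 0 * enorm (y - x) ^+ 2.
pose q y := eps^-1 * K y + q0 y.
have modelE y : bregman_model f g K eps x y = (g y + (q y)%:E)%E.
  rewrite /bregman_model [X in (X + _)%E]addeC -addeA -EFinD; congr (_ + _%:E)%E.
  rewrite /q /q0 /bregman innerDl innerNl innerZl; ring.
have q_cont : continuous q.
  move=> y; apply: (@cvgD _ _ _ (nbhs y)).
    apply: (@cvgM _ _ (nbhs y)); first exact: cvg_cst.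
    exact: (differentiable_continuous (dK y)).
  exact: continuous_quadratic.
have [||t tr tmin] := @lsc_attains_min R _ _ (bregman_model f g K eps x)
    (@compact_cball R n x r).
- by exists x; rewrite /= subrr enorm0 (le_trans ler01).
- rewrite (_ : bregman_model _ _ _ _ _ = fun y => g y + (q y)%:E)%E; last first.
    by apply/funext.
  apply: lsc_withinD => //; exact: lower_semicontinuous_within.
exists t => y; have [yr|yr] := leP (enorm (y - x)) r; first exact: tmin.
apply: le_trans (tmin x _) _; first by rewrite /= subrr enorm0 (le_trans ler01).
apply: le_trans (coercive y); rewrite bregman_model_id leeDl// lee_fin oppr_ge0.
set e := enorm (y - x) in yr *.
have er : a + b <= c * e.
  have : c * r <= c * e by rewrite ler_pM2l// ltW.
  have -> : c * r = c + (a + b) by rewrite /r; field; exact: lt0r_neq0.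
  lra.
have e1 : 1 <= e by lra.
have : (a + b) * e <= c * e * e by rewrite ler_wpM2r//; lra.
have : a <= a * e by rewrite ler_peMr.
lra.
Qed.

(** Comparing the model at [t] with its value [g x] at [x]: the subgradient
    inequality cancels [grad f x], and the strong convexity of the kernel
    outweighs the curvature [rho]. *)
Lemma bregman_step_le_subgradient x t xi (rho : R) :
  eps * rho < m -> g x \is a fin_num -> bregman_prox f g K eps x t ->
  (g x + (inner (xi - ext_grad f x) (t - x) - rho / 2 * enorm (t - x) ^+ 2)%:E
    <= g t)%E ->
  enorm (x - t) <= 2 * eps / (m - eps * rho) * enorm xi.
Proof.
move=> rhom gx /(_ x); rewrite bregman_model_id => tx.
rewrite -(fineK gx) -EFinD => /(bregman_model_ge x) /le_trans /(_ tx).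
rewrite -(fineK gx) lee_fin innerDl innerNl (enorm_distC x t).
set e := enorm (t - x) => h.
have mr : 0 < m - eps * rho by lra.
have [->|en0] := eqVneq e 0.
  by rewrite mulr_ge0 ?enorm_ge0// divr_ge0 ?mulr_ge0 ?ltW.
have e0 : 0 < e by rewrite lt_def en0 enorm_ge0.
have := ler_inner_enorm (- xi) (t - x); rewrite enormN innerNl -/e => hxi.
have {}h : (m / (2 * eps) - rho / 2) * e ^+ 2 <= enorm xi * e by lra.
rewrite mulrAC ler_pdivlMr// -(ler_pM2r e0).
have -> : e * (m - eps * rho) * e = 2 * eps * ((m / (2 * eps) - rho / 2) * e ^+ 2).
  by field; exact: lt0r_neq0.
by rewrite -[leRHS]mulrA ler_pM2l// mulr_gt0.
Qed.

(** The subgradient inequality makes the model coercive, with quadratic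
    coefficient [m / (2 eps) - rho / 2]. *)
Lemma bregman_prox_nonempty_subgradient x xi (rho : R) :
  lower_semicontinuous g -> eps * rho < m -> g x \is a fin_num ->
  (forall y, g x + (inner (xi - ext_grad f x) (y - x)
      - rho / 2 * enorm (y - x) ^+ 2)%:E <= g y)%E ->
  bregman_prox f g K eps x !=set0.
Proof.
move=> lscg rhom gx hsub.
apply: (@bregman_prox_nonempty _ 0 (enorm xi) (m / (2 * eps) - rho / 2)) => //.
- exact: enorm_ge0.
- have -> : m / (2 * eps) - rho / 2 = (m - eps * rho) / (2 * eps).
    by field; exact: lt0r_neq0.
  by rewrite divr_gt0 ?mulr_gt0//; lra.
move=> y; have := hsub y; rewrite -(fineK gx) -EFinD => /(bregman_model_ge x).
apply: le_trans; rewrite -EFinB lee_fin innerDl innerNl.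
have := ler_inner_enorm (- xi) (y - x); rewrite enormN innerNl; lra.
Qed.

(** The descent inequality bounds [f] from above, hence [g = (f + g) - f] from
    below. *)
Lemma bregman_model_ge_objective x y (lo : R) : (lo%:E <= f y + g y)%E ->
  ((lo - fine (f x) + (m / (2 * eps) - L / 2) * enorm (y - x) ^+ 2)%:E
    <= bregman_model f g K eps x y)%E.
Proof.
move=> lo_y; have fE z := fineK (smooth_term_fin_num z sf).
have gy : ((lo - fine (f y))%:E <= g y)%E.
  by rewrite EFinB leeBlDr// fE addeC.
apply: le_trans (bregman_model_ge x gy); rewrite lee_fin.
have := @smooth_term_descent _ _ f L x y sf.
rewrite /edom /= -(fE x) -(fE y) !ltry /= => /(_ isT isT); lra.
Qed.

Lemma bregman_step_le_objective x t (lo : R) :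
  eps * L < m -> g x \is a fin_num -> bregman_prox f g K eps x t ->
  (lo%:E <= f t + g t)%E ->
  (m - eps * L) * enorm (t - x) ^+ 2 <= 2 * eps * (fine (f x + g x)%E - lo).
Proof.
move=> Lm gx /(_ x); rewrite bregman_model_id => tx.
move=> /(bregman_model_ge_objective x) /le_trans /(_ tx).
rewrite -(fineK gx) lee_fin => h.
have -> : fine (f x + (fine (g x))%:E)%E = fine (f x) + fine (g x).
  by rewrite -(fineK (smooth_term_fin_num x sf)).
have -> : (m - eps * L) * enorm (t - x) ^+ 2 =
    2 * eps * ((m / (2 * eps) - L / 2) * enorm (t - x) ^+ 2).
  by field; exact: lt0r_neq0.
by rewrite ler_pM2l ?mulr_gt0//; lra.
Qed.

(** A lower bound on [f + g] makes the model coercive, with quadratic coefficient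
    [m / (2 eps) - L / 2]. *)
Lemma bregman_prox_nonempty_objective x (lo : R) :
  lower_semicontinuous g -> eps * L < m -> g x \is a fin_num ->
  (forall y, lo%:E <= f y + g y)%E ->
  bregman_prox f g K eps x !=set0.
Proof.
move=> lscg Lm gx hlo.
apply: (@bregman_prox_nonempty _ `|fine (f x) + fine (g x) - lo| 0
  (m / (2 * eps) - L / 2)) => //.
- have -> : m / (2 * eps) - L / 2 = (m - eps * L) / (2 * eps).
    by field; exact: lt0r_neq0.
  by rewrite divr_gt0 ?mulr_gt0//; lra.
move=> y; apply: le_trans (bregman_model_ge_objective x (hlo y)).
rewrite -(fineK gx) -EFinB lee_fin.
have := ler_norm (fine (f x) + fine (g x) - lo); lra.
Qed.

End BregmanSteps.

(** * Special subgradient inequalities *)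

Section SufficientConditions.
Context {R : realType} {n : nat}.
Implicit Types (f g F : 'rV[R]_n -> \bar R) (x y xi xbar : 'rV[R]_n).

(** Test the quadratic minorant at [x + s v] with [s] small. *)
Lemma proximal_subdiff_zero g x v :
  (forall y, g y = 0%E) -> proximal_subdiff g x v -> v = 0.
Proof.
move=> g0 [_ [rho [r [rho0 r0 hv]]]].
have v_ge0 := enorm_ge0 v.
pose s := Num.min (r / (2 * (enorm v + 1))) (2 * rho)^-1.
have s0 : 0 < s by rewrite lt_min divr_gt0 ?invr_gt0 ?mulr_gt0//; lra.
have sv : s * (enorm v + 1) <= r / 2.
  have -> : r / 2 = r / (2 * (enorm v + 1)) * (enorm v + 1) by field; lra.
  by rewrite ler_pM2r ?ge_min ?lexx//; lra.
have srho : rho * s <= 2^-1.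
  have -> : 2^-1 = rho * (2 * rho)^-1 by field; lra.
  by rewrite ler_pM2l// ge_min lexx orbT.
have := hv (x + s *: v); rewrite /eball /= [x + _]addrC addrK enormZ gtr0_norm//.
have -> : s * enorm v < r by lra.
rewrite !g0 add0e lee_fin innerZr -enorm_sqr => /(_ isT) h.
apply: enorm_eq0; apply/eqP; rewrite -sqrf_eq0 eq_le sqr_ge0 andbT.
have : s * (enorm v ^+ 2 * 2^-1) <= s * 0.
  have : rho * s * (s * enorm v ^+ 2) <= 2^-1 * (s * enorm v ^+ 2).
    by rewrite ler_wpM2r// mulr_ge0 ?sqr_ge0// ltW.
  lra.
by rewrite ler_pM2l//; lra.
Qed.

Lemma KL_on_proximal F xbar (alpha eta nu : R) : F xbar \is a fin_num ->
  KL_on F xbar alpha eta nu ->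
  exists2 c, 0 < c & forall x xi, level_nbhd F xbar eta nu x ->
    proximal_subdiff F x xi ->
    c * (fine (F x) - fine (F xbar)) `^ alpha <= enorm xi.
Proof.
move=> Fxbar [c [c0 KL]]; exists c => // x xi xin sub_x.
have Fx := level_nbhd_fin_num Fxbar xin.
have := le_trans (KL x xin) (edist_to_le 0 (proximal_sub_limiting sub_x)).
by rewrite sub0r enormN -{1}(fineK Fx) -{1}(fineK Fxbar) -EFinB poweR_EFin lee_fin.
Qed.

(** For [g = 0] the only possible subgradient is [grad f x], and the square root
    of the Polyak-Lojasiewicz inequality is a Kurdyka-Lojasiewicz inequality of
    exponent 1/2. *)
Lemma LPL_on_KL f g L xbar (eta : R) :
  smooth_term f L -> (forall y, g y = 0%E) -> 0 < eta -> LPL_on f xbar eta ->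
  exists2 c, 0 < c & forall x xi, eball xbar eta x ->
    (f xbar + g xbar < f x + g x)%E ->
    proximal_subdiff (fun y => f y + g y)%E x xi ->
    c * (fine (f x + g x)%E - fine (f xbar + g xbar)%E) `^ (2^-1) <= enorm xi.
Proof.
move=> sf g0 eta0 [mu [mu0 LPL]]; have fE z := fineK (smooth_term_fin_num z sf).
exists (Num.sqrt (2 * mu)) => [|x xi xeta].
  by rewrite sqrtr_gt0 mulr_gt0.
rewrite !g0 !adde0 -{1}(fE x) -{1}(fE xbar) lte_fin => lt_fx sub_x.
have := proximal_subdiff_zero g0 (proximal_subdiff_subr sf sub_x).
move/eqP; rewrite subr_eq0 => /eqP xiE.
have := LPL x xeta; rewrite -xiE -(fE x) -(fE xbar) -EFinB -EFinM lee_fin /= => h.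
rewrite powR12_sqrt ?subr_ge0; last exact: ltW.
rewrite -sqrtrM; last by rewrite mulr_ge0// ltW.
rewrite -[leRHS](ger0_norm (enorm_ge0 xi)) -[leRHS]sqrtr_sqr.
rewrite ler_sqrt ?sqr_ge0//; lra.
Qed.

End SufficientConditions.

(** * Error bounds from Bregman proximal steps *)

Section BregmanErrorBound.
Context {R : realType} {n : nat}.
Implicit Types x xi : 'rV[R]_n.
Variables (f g : 'rV[R]_n -> \bar R) (K : 'rV[R]_n -> R) (L m M eps : R).
Hypotheses (sf : smooth_term f L).
Hypotheses (hK : bregman_kernel K m M) (eps0 : 0 < eps).
Let F := fun x => (f x + g x)%E.

Lemma nonsmooth_term_fin_num x : F x \is a fin_num -> g x \is a fin_num.
Proof.
rewrite /F -(fineK (smooth_term_fin_num x sf)).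
by case: (g x).
Qed.

(** A Bregman proximal step is at most as long as a multiple of any proximal
    subgradient, so the proximal error bound becomes a subgradient bound. *)
Lemma edist_critical_le_subgradient x xi (rho c4 : R) :
  eps * rho < m -> 0 < c4 -> F x \is a fin_num ->
  bregman_prox f g K eps x !=set0 ->
  (forall t, bregman_prox f g K eps x t ->
    g x + (inner (xi - ext_grad f x) (t - x)
      - rho / 2 * enorm (t - x) ^+ 2)%:E <= g t)%E ->
  (edist_to x (prox_critical F) <= c4%:E * edist_to x (bregman_prox f g K eps x))%E ->
  (edist_to x (prox_critical F)
    <= (c4 * (2 * eps / (m - eps * rho)) * enorm xi)%:E)%E.
Proof.
move=> rhom c40 Fx [t tx] hsub /le_trans; apply.
rewrite -mulrA EFinM lee_pmul2l//; apply: le_trans (edist_to_le x tx) _.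
rewrite lee_fin; apply: (bregman_step_le_subgradient hK eps0 rhom _ tx).
  exact: nonsmooth_term_fin_num.
exact: hsub.
Qed.

Hypothesis hg : nonsmooth_term g.
Variables (xbar : 'rV[R]_n) (eta nu rho : R).
Hypotheses (Fxbar : F xbar \is a fin_num) (eta0 : 0 < eta) (nu0 : 0 < nu).
Hypotheses (h3 : H3 F xbar) (rhom : eps * rho < m).
Hypothesis bpeb : bregman_prox_error_bound_on f g K eps xbar eta nu.

Let lscg : lower_semicontinuous g. Proof. by have [_ ?] := hg. Qed.

Lemma level_set_error_bound_semi_convex :
  semi_convex g rho -> level_set_subdiff_error_bound F xbar.
Proof.
move=> scg; have [c4 [c40 hc4]] := bpeb.
apply: (@level_set_error_bound_of_critical _ _ F xbar eta nu
  (c4 * (2 * eps / (m - eps * rho)))) => //.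
  by rewrite mulr_gt0// divr_gt0 ?mulr_gt0// subr_gt0.
move=> x xi xin sub_x; have Fx := level_nbhd_fin_num Fxbar xin.
have sub_g y := semi_convex_subgradient y scg (proximal_subdiff_subr sf sub_x).
apply: (edist_critical_le_subgradient rhom c40 Fx) => [|t _|].
- apply: (bregman_prox_nonempty_subgradient hK eps0 lscg rhom _ sub_g).
  exact: nonsmooth_term_fin_num.
- exact: sub_g.
- exact: hc4.
Qed.

(** Property (A) makes the Bregman step so short, through the descent
    inequality, that it stays in the ball where prox-regularity applies. *)
Lemma level_set_error_bound_prox_regular (eps_hi N : R) :
  level_bounded F -> eps <= eps_hi -> eps_hi * L < m ->
  uniformly_prox_regular g xbar rho eta ->
  2 * eps_hi * nu / (m - eps_hi * L) / (eta / 2) ^+ 2 <= N ->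
  (forall x, level_nbhd F xbar (eta / 2) (nu / N) x ->
     property_A f g K eps xbar x) ->
  level_set_subdiff_error_bound F xbar.
Proof.
move=> lbF eps_le Lm_hi prg hN propA; have [c4 [c40 hc4]] := bpeb.
have [[gNy _] _ _ _] := hg; have [_ _ m0 _ _] := hK.
have [[fNy _] _ _ _ _] := sf.
have eps_hi0 : 0 < eps_hi by exact: lt_le_trans eps_le.
have step_le : eps * (m - eps_hi * L) <= eps_hi * (m - eps * L).
  have : eps * m <= eps_hi * m by rewrite ler_pM2r.
  lra.
have Lm : eps * L < m.
  rewrite -subr_gt0 -(pmulr_rgt0 _ eps_hi0); apply: lt_le_trans step_le.
  by rewrite mulr_gt0// subr_gt0.
have Lm_hi0 : 0 < m - eps_hi * L by rewrite subr_gt0.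
have N0 : 0 < N.
  by apply: lt_le_trans hN; rewrite !divr_gt0 ?mulr_gt0 ?exprn_gt0 ?divr_gt0.
have [B FB] : exists B : R, forall y, (B%:E <= F y)%E.
  apply: (level_bounded_lower_bound (x := xbar)) => // [|y].
    exact: lower_semicontinuous_sum sf lscg.
  rewrite /F -(fineK (smooth_term_fin_num y sf)); case: (g y) (gNy y) => // b _.
  by rewrite -EFinD ltNyr.
apply: (@level_set_error_bound_of_critical _ _ F xbar (eta / 2)
  (Num.min nu (nu / N)) (c4 * (2 * eps / (m - eps * rho)))) => //.
- by rewrite divr_gt0.
- by rewrite lt_min nu0 divr_gt0.
- by rewrite mulr_gt0// divr_gt0 ?mulr_gt0// subr_gt0.
move=> x xi [xeta [Flo Fhi]] sub_x.
have [Fhi1 Fhi2] : (F x < F xbar + nu%:E /\ F x < F xbar + (nu / N)%:E)%E.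
  by split; apply: lt_le_trans Fhi _; rewrite leeD2l// lee_fin ge_min lexx ?orbT.
have xin : level_nbhd F xbar eta nu x.
  by split=> //; move: xeta eta0; rewrite /eball /=; lra.
have xinN : level_nbhd F xbar (eta / 2) (nu / N) x by [].
have Fx := level_nbhd_fin_num Fxbar xin.
have gx := nonsmooth_term_fin_num Fx.
apply: (edist_critical_le_subgradient rhom c40 Fx) => [|t tx|].
- exact: (bregman_prox_nonempty_objective sf hK eps0 lscg Lm gx FB).
- have Ft : ((fine (F xbar))%:E <= f t + g t)%E.
    by rewrite fineK//; exact: propA xinN t tx.
  have := bregman_step_le_objective sf hK eps0 Lm gx tx Ft.
  rewrite -/(F x) => ht.
  have gap : fine (F x) - fine (F xbar) < nu / N.
    by rewrite ltrBlDl -lte_fin EFinD !fineK.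
  have Nnu : 2 * eps_hi * (nu / N) <= (m - eps_hi * L) * (eta / 2) ^+ 2.
    move: hN; rewrite -mulrA -invfM ler_pdivrMr; last first.
      by rewrite mulr_gt0// exprn_gt0// divr_gt0.
    by move=> hN'; rewrite mulrA ler_pdivrMr// [leRHS]mulrC.
  have tx_le : enorm (t - x) <= eta / 2.
    rewrite -ler_sqr ?nnegrE ?enorm_ge0//; last by rewrite divr_ge0// ltW.
    have mL : 0 < eps_hi * (m - eps * L) by rewrite mulr_gt0// subr_gt0.
    rewrite -(ler_pM2l mL).
    have h1 : eps_hi * ((m - eps * L) * enorm (t - x) ^+ 2) <=
        eps_hi * (2 * eps * (nu / N)).
      rewrite ler_pM2l//; apply: le_trans ht _; rewrite ler_pM2l ?mulr_gt0//.
      exact: ltW.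
    have h2 : eps * (2 * eps_hi * (nu / N)) <=
        eps * ((m - eps_hi * L) * (eta / 2) ^+ 2) by rewrite ler_pM2l.
    have h4 : eps * (m - eps_hi * L) * (eta / 2) ^+ 2 <=
        eps_hi * (m - eps * L) * (eta / 2) ^+ 2 by rewrite ler_wpM2r ?sqr_ge0.
    lra.
  apply: prg.
  + by move: xeta eta0; rewrite /eball /=; lra.
  + by have := enorm_triangle x t xbar; move: xeta; rewrite /eball /=; lra.
  + by apply: proximal_sub_limiting; exact: proximal_subdiff_subr sf sub_x.
- exact: hc4.
Qed.

End BregmanErrorBound.

Theorem theorem8p1 (R : realType) (n : nat)
    (f g : 'rV[R]_n -> \bar R) (K : 'rV[R]_n -> R)
    (L m M eps_lo eps eps_hi : R) (xbar : 'rV[R]_n)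
    (F := fun x => (f x + g x)%E)
    (hf : smooth_term f L)
    (hg : nonsmooth_term g)
    (hF : level_bounded F)
    (hK : bregman_kernel K m M)
    (heps_lo : 0 < eps_lo) (heps_ge : eps_lo <= eps) (heps_le : eps <= eps_hi)
    (hxbar : prox_critical F xbar)
    (hcond :
      (* (i) *)
      (exists alpha eta nu : R,
        [/\ 0 < alpha < 1, 0 < eta, 0 < nu & KL_on F xbar alpha eta nu])
      \/
      (* (ii) *)
      (exists eta nu : R,
        [/\ 0 < eta, 0 < nu,
            bregman_prox_error_bound_on f g K eps xbar eta nu,
            H3 F xbar &
            (exists rho : R, semi_convex g rho /\ eps * rho < m)
            \/
            (exists rho N : R,
              [/\ 0 <= rho, eps * rho < m,
                  uniformly_prox_regular g xbar rho eta,
                  eps_hi * L < m /\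
                  2 * eps_hi * nu / (m - eps_hi * L) / (eta / 2) ^+ 2 <= N &
                  forall x, level_nbhd F xbar (eta / 2) (nu / N) x ->
                    property_A f g K eps xbar x])])
      \/
      (* (iii) *)
      (weak_metric_subregularity F xbar /\ H3 F xbar)
      \/
      (* (iv) *)
      ((forall x, g x = 0%E) /\
       exists eta : R, 0 < eta /\ LPL_on f xbar eta)) :
  level_set_subdiff_error_bound F xbar.
Proof.
have eps0 : 0 < eps by exact: lt_le_trans heps_ge.
have [Fxbar _] := hxbar.
have [_ lscg _ _] := hg.
have lscF : lower_semicontinuous F by exact: lower_semicontinuous_sum hf lscg.
case: hcond => [|[|[]]].
- move=> [alpha [eta [nu [alpha01 eta0 nu0 /(KL_on_proximal Fxbar)[c c0 KL]]]]].
  exact: level_set_error_bound_of_KL lscF Fxbar alpha01 eta0 nu0 c0 KL.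
- move=> [eta [nu [eta0 nu0 bpeb h3 []]]].
    move=> [rho [scg rhom]].
    exact: (level_set_error_bound_semi_convex hf hK eps0 hg Fxbar eta0 nu0 h3 rhom
      bpeb scg).
  move=> [rho [N [_ rhom prg [Lm_hi hN] propA]]].
  exact: (level_set_error_bound_prox_regular hf hK eps0 hg Fxbar eta0 nu0 h3 rhom
    bpeb hF heps_le Lm_hi prg hN propA).
- move=> [[eta [nu [c5 [eta0 nu0 c50 wms]]]] h3].
  apply: (@level_set_error_bound_of_critical _ _ F xbar eta nu c5^-1) => //.
    by rewrite invr_gt0.
  move=> x xi xin sub_x.
  have := le_trans (wms x xin) (edist_to_le 0 sub_x).
  by rewrite sub0r enormN EFinM lee_pdivlMl.
- move=> [g0 [eta [eta0 lpl]]].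
  have [c c0 KL] := LPL_on_KL hf g0 eta0 lpl.
  have half01 : 0 < (2^-1 : R) < 1 by apply/andP; split; lra.
  apply: (level_set_error_bound_of_KL lscF Fxbar half01 eta0 ltr01 c0).
  by move=> x xi [xeta [Flo _]]; exact: KL.
Qed.
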